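(* Fix a mesh size $h>0$. For $\omega_B\in\mathbb{R}$ and $\boldsymbol\theta\in T^{\rm high}$ let $$\widetilde{\mathcal S}_B(\omega_B,\boldsymbol\theta)=I-\omega_B\,\widetilde M_B(\boldsymbol\theta)^{-1}\,\widetilde{\mathcal L}(\boldsymbol\theta)$$ be the $3\times3$ error-propagation symbol of the (exact) mass-based Braess-Sarazin relaxation ($Q$-BSR). Then the optimal smoothing factor is $$\mu_{{\rm opt},B}=\min_{\omega_B\in\mathbb{R}}\ \max_{\boldsymbol\theta\in T^{\rm high}}\ \big|\lambda\big(\widetilde{\mathcal S}_B(\omega_B,\boldsymbol\theta)\big)\big|=\frac13,$$ where $\lambda(\cdot)$ ranges over all eigenvalues of the matrix, and the minimum is uniquely achieved at $\omega_B=\frac34$.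
   Context: Setting: local Fourier analysis of multigrid relaxation for the 2D Stokes equations discretized by the staggered (MAC) finite-difference scheme on a uniform mesh of size $h$. Operators are represented by their symbols (complex matrices depending on $\boldsymbol\theta=(\theta_1,\theta_2)$). High frequencies: $T^{\rm high}=[-\frac{\pi}{2},\frac{3\pi}{2})^2\setminus[-\frac{\pi}{2},\frac{\pi}{2})^2$. $m(\boldsymbol\theta)=\sin^2(\theta_1/2)+\sin^2(\theta_2/2)$, so that the five-point scalar (negative) Laplacian has symbol $4m(\boldsymbol\theta)/h^2$. The bilinear finite element mass stencil $Q$ has symbol $\widetilde Q=\frac{h^2}{9}(2+\cos\theta_1)(2+\cos\theta_2)$, and $m_s(\boldsymbol\theta)=\left(\frac19(2+\cos\theta_1)(2+\cos\theta_2)\right)^{-1}$, i.e. $\widetilde Q = h^2/m_s$. Symbol of the discrete Stokes operator: $$\widetilde{\mathcal L}(\boldsymbol\theta)=\frac1{h^2}\begin{pmatrix} 4m & 0 & i2h\sin\frac{\theta_1}{2} \\ 0 & 4m & i2h\sin\frac{\theta_2}{2} \\ -i2h\sin\frac{\theta_1}{2} & -i2h\sin\frac{\theta_2}{2} & 0 \end{pmatrix}.$$ Symbol of the Braess-Sarazin operator $M_B=\begin{pmatrix} \alpha C & B^T \\ B & 0 \end{pmatrix}$ with $\alpha=1$ and $C^{-1}={\rm diag}(Q,Q)$, where $B$ is the negative of the discrete divergence operator: $$\widetilde M_B(\boldsymbol\theta)=\frac1{h^2}\begin{pmatrix} m_s & 0 & i2h\sin\frac{\theta_1}{2} \\ 0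 & m_s & i2h\sin\frac{\theta_2}{2} \\ -i2h\sin\frac{\theta_1}{2} & -i2h\sin\frac{\theta_2}{2} & 0 \end{pmatrix}.$$ *)

(* Defs.v *)
From mathcomp Require Import all_boot all_order all_algebra.
From mathcomp Require Import all_classical all_reals all_analysis.
From mathcomp Require Import complex.

Set Implicit Arguments.
Unset Strict Implicit.
Unset Printing Implicit Defensive.

Import Order.TTheory GRing.Theory Num.Theory.
Local Open Scope classical_set_scope.
Local Open Scope ring_scope.

Definition Thigh (R : realType) : set (R * R) :=
  let full := `[- (pi / 2), 3 * pi / 2[%classic in
  let low := `[- (pi / 2), pi / 2[%classic in
  (full `*` full) `\` (low `*` low).

Definition m_symbol (R : realType) (theta : R * R) : R :=
  sin (theta.1 / 2) ^+ 2 + sin (theta.2 / 2) ^+ 2.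

Definition ms_symbol (R : realType) (theta : R * R) : R :=
  (9^-1 * (2 + cos theta.1) * (2 + cos theta.2))^-1.

(* The common block structure of the Stokes and Braess-Sarazin symbols, which
   differ only in the scalar [a] on the diagonal of the velocity block. *)
Definition saddle_symbol (R : realType) (h : R) (a : R) (theta : R * R) :
    'M[R[i]]_3 :=
  let b1 : R[i] := 'i%C * (2 * h * sin (theta.1 / 2))%:C%C in
  let b2 : R[i] := 'i%C * (2 * h * sin (theta.2 / 2))%:C%C in
  (h ^- 2)%:C%C *:
  \matrix_(i < 3, j < 3)
    nth 0 (nth [::] [:: [:: a%:C%C; 0     ; b1];
                        [:: 0     ; a%:C%C; b2];
                        [:: - b1  ; - b2  ; 0 ]] i) j.

Definition L_symbol (R : realType) (h : R) (theta : R * R) : 'M[R[i]]_3 :=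
  saddle_symbol h (4 * m_symbol theta) theta.

Definition MB_symbol (R : realType) (h : R) (theta : R * R) : 'M[R[i]]_3 :=
  saddle_symbol h (ms_symbol theta) theta.

(* [invmx] is the genuine inverse here: for [h > 0] and [theta] in [Thigh],
   [\det (MB_symbol h theta) = - 4 * ms * m / h ^+ 4 != 0]. *)
Definition SB_symbol (R : realType) (h omega : R) (theta : R * R) :
    'M[R[i]]_3 :=
  1%:M - omega%:C%C *: (invmx (MB_symbol h theta) *m L_symbol h theta).

Definition SB_moduli (R : realType) (h omega : R) : set R :=
  [set r | exists theta : R * R, exists lambda : R[i],
     [/\ Thigh theta, eigenvalue (SB_symbol h omega theta) lambda
       & r = Normc.normc lambda]].

Definition is_max (R : realType) (A : set R) (x : R) : Prop :=
  A x /\ ubound A x.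

Definition is_min (R : realType) (A : set R) (x : R) : Prop :=
  A x /\ lbound A x.

(* Defined for every [omega] as a supremum; that it is a maximum is part of
   the theorem. *)
Definition smoothing_factor (R : realType) (h omega : R) : R :=
  sup (SB_moduli h omega).

(* Main.v *)
Require Import Defs.
From mathcomp Require Import all_boot all_order all_algebra.
From mathcomp Require Import all_classical all_reals all_analysis.
From mathcomp Require Import complex.
From mathcomp Require Import ring lra.
Import Order.TTheory GRing.Theory Num.Theory.
Local Open Scope classical_set_scope.
Local Open Scope ring_scope.

(** Left multiplication by [M_B] turns the eigenvalue problem for [S_B] into
    the pencil [s w L = t w M_B].  Its velocity rows give [w1 A = w3 b1 D] and
    [w2 A = w3 b2 D], with [A = t ms - 4 s m] and [D = t - s], and its pressure
    row gives [(w1 b1 + w2 b2) D = 0]; since [b1^2 + b2^2 = - 4 h^2 m] does not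
    vanish, [A D = 0].  So the eigenvalues of [S_B] are [1 - omega] and
    [1 - omega q] with
    [q = 4 m / ms = 2/9 (2 - c1 - c2) (2 + c1) (2 + c2)], [ci = cos theta_i].
    On the high frequencies one of the cosines is nonpositive, whence
    [8/9 <= q <= 16/9]: the maximum (AM-GM, the three factors add up to 6) is
    attained at [(pi/2, pi/2)] and the minimum at [(pi, pi)].  The smoothing
    factor is thus [max |1 - 8/9 omega| |1 - 16/9 omega|]. *)

(** * Eigenvalues of [S_B] through the saddle-point pencil *)

Lemma mul_row_saddle {R : realType} (h a : R) theta (w : 'rV[R[i]]_3) :
  let b1 : R[i] := 'i%C * (2 * h * sin (theta.1 / 2))%:C%C in
  let b2 : R[i] := 'i%C * (2 * h * sin (theta.2 / 2))%:C%C in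
  [/\ (w *m saddle_symbol h a theta) 0 0 =
        (h ^- 2)%:C%C * (w 0 0 * a%:C%C - w 0 2%R * b1),
      (w *m saddle_symbol h a theta) 0 1 =
        (h ^- 2)%:C%C * (w 0 1 * a%:C%C - w 0 2%R * b2)
    & (w *m saddle_symbol h a theta) 0 2%R =
        (h ^- 2)%:C%C * (w 0 0 * b1 + w 0 1 * b2)].
Proof.
move=> b1 b2.
have E0 : lift ord0 ord0 = 1 :> 'I_3 by apply/val_inj.
have E1 : lift ord0 (lift ord0 ord0) = 2%R :> 'I_3 by apply/val_inj.
split; rewrite mxE !big_ord_recl big_ord0 ?E0 ?E1 /saddle_symbol !mxE /=;
  rewrite -/b1 -/b2; ring.
Qed.

Lemma row3P {T : Type} (u v : 'rV[T]_3) :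
  u 0 0 = v 0 0 -> u 0 1 = v 0 1 -> u 0 2%R = v 0 2%R -> u = v.
Proof.
move=> e0 e1 e2; apply/rowP => -[[|[|[|//]]] lti].
- by rewrite (_ : Ordinal _ = 0) //; apply/val_inj.
- by rewrite (_ : Ordinal _ = 1) //; apply/val_inj.
- by rewrite (_ : Ordinal _ = 2%R) //; apply/val_inj.
Qed.

(** Both diagonals and both coefficients stay free, so that the invertibility of [M_B] and the
    spectrum of [S_B] come from the same elimination. *)
Lemma saddle_pencil {R : realType} (h a l : R) theta (s t : R[i])
    (w : 'rV[R[i]]_3) :
  h != 0 -> m_symbol theta != 0 -> w != 0 ->
  s *: (w *m saddle_symbol h l theta) = t *: (w *m saddle_symbol h a theta) ->
  t = s \/ t * a%:C%C = s * l%:C%C.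
Proof.
move=> h0 m0 w0 e.
have hC : (h ^- 2)%:C%C != 0 :> R[i].
  by rewrite fmorph_eq0 invr_eq0 expf_neq0.
move: (mul_row_saddle h a theta w) (mul_row_saddle h l theta w) => /=.
set b1 := 'i%C * _; set b2 := 'i%C * _ => -[La0 La1 La2] [Ll0 Ll1 Ll2].
have bb : b1 ^+ 2 + b2 ^+ 2 != 0.
  rewrite (_ : _ + _ = (- (4 * h ^+ 2 * m_symbol theta))%:C%C).
    by rewrite fmorph_eq0 oppr_eq0 !mulf_neq0 // ?expf_neq0 // pnatr_eq0.
  rewrite /b1 /b2 !exprMn sqr_i -!rmorphXn -mulrDr -rmorphD /= mulN1r -rmorphN.
  by congr (_%:C%C); rewrite /m_symbol; ring.
set A := t * a%:C%C - s * l%:C%C; set D := t - s.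
have e0 : w 0 0 * A = w 0 2%R * b1 * D.
  have := congr1 (fun u : 'rV_3 => u 0 0) e.
  rewrite /= [LHS]mxE [RHS]mxE La0 Ll0 ![_ * (_%:C%C * _)]mulrCA.
  move=> /(mulfI hC) e0.
  apply: subr0_eq; move/esym/eqP: e0; rewrite -subr_eq0 => /eqP <-.
  by rewrite /A /D; ring.
have e1 : w 0 1 * A = w 0 2%R * b2 * D.
  have := congr1 (fun u : 'rV_3 => u 0 1) e.
  rewrite /= [LHS]mxE [RHS]mxE La1 Ll1 ![_ * (_%:C%C * _)]mulrCA.
  move=> /(mulfI hC) e1.
  apply: subr0_eq; move/esym/eqP: e1; rewrite -subr_eq0 => /eqP <-.
  by rewrite /A /D; ring.
have e2 : (w 0 0 * b1 + w 0 1 * b2) * D = 0.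
  have := congr1 (fun u : 'rV_3 => u 0 2%R) e.
  rewrite /= [LHS]mxE [RHS]mxE La2 Ll2 ![_ * (_%:C%C * _)]mulrCA.
  move=> /(mulfI hC) e2.
  by rewrite mulrC mulrBl e2 subrr.
have [D0|D0] := eqVneq D 0; first by left; apply/eqP; rewrite -subr_eq0 -/D D0.
right; apply/eqP; rewrite -subr_eq0 -/A; apply: contraNT w0 => A0.
have w2 : w 0 2%R = 0.
  (* Multiplying the pressure row by [A] and inserting the velocity rows leaves only the pressure
     unknown. *)
  have : w 0 2%R * ((b1 ^+ 2 + b2 ^+ 2) * D ^+ 2) = 0.
    transitivity (D * (w 0 2%R * b1 * D * b1 + w 0 2%R * b2 * D * b2)).
      ring.
    rewrite -e0 -e1; transitivity (A * ((w 0 0 * b1 + w 0 1 * b2) * D)).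
      ring.
    by rewrite e2 mulr0.
  move/eqP; rewrite !mulf_eq0 (negPf bb) (negPf D0) !orbF.
  by move/eqP.
move: e0 e1; rewrite w2 !mul0r => /eqP + /eqP.
rewrite !mulf_eq0 (negPf A0) !orbF => /eqP w0 /eqP w1.
by apply/eqP; apply: row3P; rewrite ?w0 ?w1 ?w2 mxE.
Qed.

(** A nonzero left null vector would solve the pencil with [s = 0] and [t = 1], forcing [1 = 0] or
    [ms = 0]. *)
Lemma MB_unitmx {R : realType} (h : R) theta :
  h != 0 -> m_symbol theta != 0 -> ms_symbol theta != 0 ->
  MB_symbol h theta \in unitmx.
Proof.
move=> h0 m0 a0; rewrite -row_free_unit -kermx_eq0.
apply/rowV0P => w /sub_kermxP wM.
apply/eqP; apply: contraT => w0.
have := saddle_pencil h (ms_symbol theta) 0 theta 0 1 w h0 m0 w0.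
rewrite scale0r -/(MB_symbol h theta) wM scaler0 mul0r mul1r.
by case=> // /eqP; rewrite ?oner_eq0 // fmorph_eq0 (negPf a0).
Qed.

Lemma eigenvalue_SB {R : realType} (h omega : R) theta lambda :
  h != 0 -> m_symbol theta != 0 -> ms_symbol theta != 0 ->
  eigenvalue (SB_symbol h omega theta) lambda ->
  lambda = (1 - omega)%:C%C \/
  lambda = (1 - omega * (4 * m_symbol theta / ms_symbol theta))%:C%C.
Proof.
move=> h0 m0 a0 /eigenvalueP[v + v0].
have MU := MB_unitmx h theta h0 m0 a0.
set w := v *m invmx (MB_symbol h theta).
have vE : v = w *m MB_symbol h theta by rewrite mulmxKV.
have w0 : w != 0 by apply: contraNneq v0 => w0; rewrite vE w0 mul0mx.
rewrite /SB_symbol mulmxBr mulmx1 -scalemxAr mulmxA -/w => e.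
have {}e : omega%:C%C *: (w *m L_symbol h theta) =
    (1 - lambda) *: (w *m MB_symbol h theta).
  by rewrite -vE scalerBl scale1r -e opprB addrC subrK.
have [e1|e1] := saddle_pencil _ _ _ _ _ _ _ h0 m0 w0 e; [left|right].
  by rewrite rmorphB rmorph1 /= -e1 opprB addrC subrK.
have aC : (ms_symbol theta)%:C%C != 0 :> R[i] by rewrite fmorph_eq0.
rewrite mulrA rmorphB rmorph1 fmorph_div rmorphM /= -e1 mulfK //.
by rewrite opprB addrC subrK.
Qed.

Lemma SB_eigenvalue {R : realType} (h omega : R) theta :
  h != 0 -> m_symbol theta != 0 -> ms_symbol theta != 0 ->
  eigenvalue (SB_symbol h omega theta)
    (1 - omega * (4 * m_symbol theta / ms_symbol theta))%:C%C.
Proof.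
move=> h0 m0 a0.
have MU := MB_unitmx h theta h0 m0 a0.
(* A discretely divergence-free velocity with zero pressure. *)
pose w : 'rV[R[i]]_3 := \row_j nth 0
  [:: (sin (theta.2 / 2))%:C%C; - (sin (theta.1 / 2))%:C%C; 0] j.
have w0 : w != 0.
  apply: contraNneq m0 => w0; have := congr1 (fun u : 'rV_3 => u 0 0) w0.
  have := congr1 (fun u : 'rV_3 => u 0 1) w0.
  rewrite !mxE /= => /eqP; rewrite oppr_eq0 fmorph_eq0 => /eqP s1 /eqP.
  by rewrite fmorph_eq0 => /eqP s2; rewrite /m_symbol s1 s2 expr0n addr0.
(* The divergence of [w] and its pressure both vanish, so only the diagonal acts: [w] is a left
   eigenvector of every saddle symbol. *)
have wS a : w *m saddle_symbol h a theta = (h ^- 2 * a)%:C%C *: w.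
  have [e0 e1 e2] := mul_row_saddle h a theta w.
  by apply: row3P; rewrite ?e0 ?e1 ?e2 !mxE /=; rewrite !rmorphM /=; ring.
apply/eigenvalueP; exists (w *m MB_symbol h theta); last first.
  by apply: contraNneq w0 => e; rewrite -(mulmxK MU w) e mul0mx.
rewrite /SB_symbol mulmxBr mulmx1 -(scalemxAr omega%:C%C) mulmxA mulmxK //.
rewrite /L_symbol /MB_symbol !wS !scalerA -scalerBl -!rmorphM -rmorphB.
by congr (_%:C%C *: _); field; rewrite a0 h0.
Qed.

(** * Range of the quotient [q] over the high frequencies *)

Lemma sin2_half {R : realType} (x : R) : sin (x / 2) ^+ 2 = (1 - cos x) / 2.
Proof.
have {2}-> : x = (x / 2) *+ 2 by rewrite -[RHS]mulr_natr divfK // pnatr_eq0.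
by rewrite cos_mulr2n; have := cos2Dsin2 (x / 2); lra.
Qed.

Lemma m_symbolE {R : realType} (theta : R * R) :
  m_symbol theta = (2 - cos theta.1 - cos theta.2) / 2.
Proof. by rewrite /m_symbol !sin2_half; lra. Qed.

Lemma symbol_quotientE {R : realType} (theta : R * R) :
  4 * m_symbol theta / ms_symbol theta =
  2 / 9 * ((2 - cos theta.1 - cos theta.2) * (2 + cos theta.1)
           * (2 + cos theta.2)).
Proof. by rewrite m_symbolE /ms_symbol invrK; field. Qed.

Lemma cos_le0_high {R : realType} (x : R) :
  pi / 2 <= x <= 3 * pi / 2 -> cos x <= 0.
Proof.
move=> hx; rewrite -[x](subrK pi) cosDpi oppr_le0 cos_ge0_pihalf //.
by move: hx; lra.
Qed.

Lemma Thigh_cos_le0 {R : realType} (theta : R * R) :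
  Thigh theta -> cos theta.1 <= 0 \/ cos theta.2 <= 0.
Proof.
case: theta => x y [[/= hx hy] nlow].
move: hx hy; rewrite /= !in_itv /= => hx hy.
have [xlo|xhi] := ltP x (pi / 2); last by left; apply: cos_le0_high; lra.
have [ylo|yhi] := ltP y (pi / 2); last by right; apply: cos_le0_high; lra.
by case: nlow; split; rewrite /= in_itv /=; lra.
Qed.

Lemma ms_symbol_neq0 {R : realType} (theta : R * R) : ms_symbol theta != 0.
Proof.
have := cos_geN1 theta.1; have := cos_geN1 theta.2 => h2 h1.
by rewrite invr_eq0 !mulf_neq0 //; lra.
Qed.

Lemma m_symbol_neq0 {R : realType} (theta : R * R) :
  Thigh theta -> m_symbol theta != 0.
Proof.
rewrite m_symbolE => /Thigh_cos_le0.
by have := cos_le1 theta.1; have := cos_le1 theta.2 => ? ? [] ?; lra.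
Qed.

(** Here [x] is the cosine that high frequency makes nonpositive; at [x = y = 1] the product would
    vanish. The bounds are attained at [(-1, -1)] and [(0, 0)]. *)
Lemma cubic_bounds {R : realFieldType} (x y : R) :
  -1 <= x <= 0 -> -1 <= y <= 1 ->
  4 <= (2 - x - y) * (2 + x) * (2 + y) <= 8.
Proof.
move=> /andP[x1 x0] /andP[y1 y2]; apply/andP; split.
  (* Concave in [y], hence minimal at [y = -1] or [y = 1]. *)
  have -> : (2 - x - y) * (2 + x) * (2 + y) =
      4 + (2 + x) * (1 - y) * (1 + y) + (1 - y) / 2 * (1 + x) * (- x + 2)
      + (1 + y) / 2 * (2 + 3 * (- x) * (1 + x)) by field.
  have xx : 0 <= - x * (1 + x) by rewrite mulr_ge0 //; lra.
  by rewrite -2!addrA lerDl !addr_ge0 ?mulr_ge0 //; lra.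
(* Completing the square in [x] at fixed [y], with vertex [x = - y / 2]. *)
have -> : (2 - x - y) * (2 + x) * (2 + y) =
  8 - (2 + y) * (x + y / 2) ^+ 2 - (6 - y) / 4 * y ^+ 2 by field.
by rewrite -addrA gerDl -opprD oppr_le0 addr_ge0 // mulr_ge0 ?sqr_ge0 //; lra.
Qed.

Lemma symbol_quotient_bounds {R : realType} (theta : R * R) :
  Thigh theta -> 8 / 9 <= 4 * m_symbol theta / ms_symbol theta <= 16 / 9.
Proof.
have [] := (cos_geN1 theta.1, cos_geN1 theta.2) => a1 a2.
have [] := (cos_le1 theta.1, cos_le1 theta.2) => b1 b2.
rewrite symbol_quotientE => /Thigh_cos_le0[c0|c0].
  have := cubic_bounds (cos theta.1) (cos theta.2); rewrite a1 a2 b2 c0.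
  by move=> /(_ isT isT); lra.
have := cubic_bounds (cos theta.2) (cos theta.1); rewrite a1 a2 b1 c0.
rewrite (_ : 2 - cos theta.2 - cos theta.1 = 2 - cos theta.1 - cos theta.2).
  by rewrite mulrAC => /(_ isT isT); lra.
by ring.
Qed.

(** * Maximum over the frequencies and optimal parameter *)

Lemma Thigh_diag {R : realType} (x : R) :
  pi / 2 <= x < 3 * pi / 2 -> Thigh (x, x).
Proof.
have := pi_gt0 R => p0 hx.
split; last by case=> /=; rewrite in_itv /=; lra.
by split; rewrite /= in_itv /=; lra.
Qed.

Lemma normc_real {R : rcfType} (x : R) : Normc.normc x%:C%C = `|x|.
Proof. by rewrite /= expr0n addr0 sqrtr_sqr. Qed.

(** The diagonal suffices for attainment, since both extremal frequencies lie on it. *)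
Lemma SB_moduli_quotient {R : realType} (h omega x : R) :
  h != 0 -> pi / 2 <= x < 3 * pi / 2 ->
  SB_moduli h omega
    `|1 - omega * (2 / 9 * ((2 - cos x - cos x) * (2 + cos x) * (2 + cos x)))|.
Proof.
move=> h0 /Thigh_diag Tx; exists (x, x); eexists; split=> //.
  by apply: SB_eigenvalue => //; [exact: m_symbol_neq0|exact: ms_symbol_neq0].
by rewrite symbol_quotientE normc_real.
Qed.

(** The modulus of [1 - omega * t] is convex in [t], so over [[8/9, 16/9]] it is largest at an
    endpoint. *)
Lemma SB_moduli_max {R : realType} (h omega : R) : h != 0 ->
  is_max (SB_moduli h omega)
    (Num.max `|1 - omega * (8 / 9)| `|1 - omega * (16 / 9)|).
Proof.
move=> h0; have := pi_gt0 R => p0; split.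
  have := SB_moduli_quotient h omega pi h0; rewrite cospi.
  rewrite [2 / 9 * _](_ : _ = 8 / 9); last by field.
  have := SB_moduli_quotient h omega (pi / 2) h0; rewrite cos_pihalf.
  rewrite [2 / 9 * _](_ : _ = 16 / 9); last by field.
  by move=> P1 P2; rewrite maxEle; case: ifP => _; [apply: P1|apply: P2]; lra.
move=> r [theta [lambda [Tt ev ->]]].
have [t t_itv ->] : exists2 t, 8 / 9 <= t <= 16 / 9 &
    lambda = (1 - omega * t)%:C%C.
  have [->|->] := eigenvalue_SB h omega theta lambda h0 (m_symbol_neq0 _ Tt)
    (ms_symbol_neq0 _) ev.
  (* The eigenvalue [1 - omega] is the case [t = 1], inside the interval. *)
  - by exists 1; [lra | rewrite mulr1].
  - by eexists; first exact: symbol_quotient_bounds Tt.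
rewrite normc_real le_max; apply/orP; case/andP: t_itv => t1 t2.
have [w0|w0] := lerP omega 0.
  right; rewrite ger0_norm; last by nra.
  by apply: le_trans (ler_norm _); nra.
have [wt|wt] := lerP 0 (1 - omega * t).
  by left; rewrite ger0_norm //; apply: le_trans (ler_norm _); nra.
right; rewrite ltr0_norm // -[leRHS]normrN.
by apply: le_trans (ler_norm _); nra.
Qed.

Lemma smoothing_factorE {R : realType} (h omega : R) : h != 0 ->
  smoothing_factor h omega =
  Num.max `|1 - omega * (8 / 9)| `|1 - omega * (16 / 9)|.
Proof.
move=> /(SB_moduli_max h omega)[Amax ubmax]; apply/eqP; rewrite eq_le.
rewrite ge_sup //; last by eexists; exact: Amax.
by rewrite ub_le_sup //; eexists; exact: ubmax.
Qed.

Theorem theorem3p2 (R : realType) (h : R) (h_gt0 : 0 < h) :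
  [/\ forall omega : R,
        is_max (SB_moduli h omega) (smoothing_factor h omega),
      is_min (range (smoothing_factor h)) (1 / 3)
    & forall omega : R, smoothing_factor h omega = 1 / 3 <-> omega = 3 / 4].
Proof.
have h0 : h != 0 by rewrite gt_eqF.
(* At [3/4 = 2 / (8/9 + 16/9)] the endpoint values are opposite, [1/3] and [-1/3]. *)
have opt : smoothing_factor h (3 / 4) = 1 / 3.
  rewrite smoothing_factorE // (_ : 1 - _ = 1 / 3); last by field.
  rewrite (_ : 1 - _ = - (1 / 3)); last by field.
  by rewrite normrN maxxx ger0_norm //; lra.
(* Below [3/4] the endpoint [8/9] gives more than [1/3]; above, [16/9] gives less than [-1/3].
   Strictness yields both minimality and uniqueness. *)
have lo omega : omega != 3 / 4 -> 1 / 3 < smoothing_factor h omega.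
  rewrite smoothing_factorE // lt_max neq_lt => /orP[w|w]; apply/orP.
    by left; apply: (lt_le_trans _ (ler_norm _)); lra.
  by right; rewrite -normrN; apply: (lt_le_trans _ (ler_norm _)); lra.
split=> [omega||omega].
- by rewrite smoothing_factorE //; exact: SB_moduli_max.
- split; first by exists (3 / 4).
  move=> _ [omega _ <-].
  by have [->|/lo/ltW//] := eqVneq omega (3 / 4); rewrite opt.
- split=> [e|->//]; apply/eqP; apply: contraT => /lo.
  by rewrite e ltxx.
Qed.
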